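(* Let $R$ be a commutative ring with $1$ and let $G$ be a Hausdorff ample groupoid. Suppose $\mathcal{B}$ is a subsemigroup of $\operatorname{Bis}_c(G)$ which is a basis for the topology on $G$ and satisfies: (Int) $\emptyset\in\mathcal{B}$ and $\mathcal{B}$ is closed under finite intersections; (RC) for all $B,C\in\mathcal{B}$, the relative complement $B\setminus C$ is a finite union of disjoint sets in $\mathcal{B}$. Then $\{\mathbf{1}_B\mid B\in\mathcal{B}\}$ is a representation of $\mathcal{B}$ in $A_R(G)$, and it generates $A_R(G)$ as an $R$-module. Moreover, for every $R$-algebra $Q$ containing a representation $\{t_B\mid B\in\mathcal{B}\}$ of $\mathcal{B}$, there is a unique $R$-algebra homomorphism $\pi:A_R(G)\to Q$ such that $\pi(\mathbf{1}_B)=t_B$ for all $B\in\mathcal{B}$.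
   Context: A groupoid $G$ is a small category with all morphisms invertible; its unit space is $G^{(0)}=\{x^{-1}x\mid x\in G\}$, source $s(x)=x^{-1}x$, range $r(x)=xx^{-1}$, and $(x,y)$ is composable iff $s(x)=r(y)$; $G_u=s^{-1}(u)$. A topological groupoid has continuous multiplication and inversion. An ample groupoid is a topological groupoid $G$ such that $s$ is a local homeomorphism and $G^{(0)}$ is locally compact, totally disconnected and Hausdorff. A compact open bisection is a compact open $B\subseteq G$ on which $s$ and $r$ are injective; $\operatorname{Bis}_c(G)$ is the set of these, an inverse semigroup under $BC=\{xy\mid x\in B,y\in C,s(x)=r(y)\}$ and $B^{-1}=\{x^{-1}\mid x\in B\}$. Steinberg algebra: $A_R(G)$ is the $R$-submodule of $R^G$ (functions $G\to R$) spanned by the characteristic functions $\mathbf{1}_B$, $B\in\operatorname{Bis}_c(G)$, with convolution product $f*g(x)=\sum_{y\in G_{s(x)}}f(xy^{-1})g(y)$. Algebras are associative but need not be unital. Representation: for a subsemigroup $\mathcal{B}\subseteq\operatorname{Bis}_c(G)$ and an $R$-algebra $Q$, a representation of $\mathcal{B}$ in $Q$ is a family $\{t_B\mid B\in\mathcal{B}\}\subseteq Q$ such that: (R1) $t_\emptyset=0$ if $\emptyset\in\mathcal{B}$; (R2) $t_At_B=t_{AB}$ for all $A,B\in\mathcal{B}$; (R3) $\sum_{B\in F}t_B=t_{\bigcup F}$ for every finite $F\subseteq\mathcal{B}$ such that $\bigcup F\in\mathcal{B}$ and $B\cap B'=\emptyset$ for distinct $B,B'\in F$. *)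

(* Defs.v *)
From HB Require Import structures.
From mathcomp Require Import all_boot all_algebra finmap.
From mathcomp Require Import all_classical.
From mathcomp Require Import topology numfun measurable_structure.

Set Implicit Arguments.
Unset Strict Implicit.
Unset Printing Implicit Defensive.
Import GRing.Theory.
Local Open Scope classical_set_scope.
Local Open Scope ring_scope.

(* A small category with all morphisms invertible, presented by its arrows:
   an object is identified with its identity arrow, so that the source and the
   range of an arrow are again arrows.  [gmul x y] is the composite when
   [gsrc x = grng y]; its value on other pairs is unspecified, and nothing
   below uses it. *)
HB.mixin Record isGroupoid G := {
  gsrc : G -> G;
  grng : G -> G;
  gmul : G -> G -> G;
  ginv : G -> G;
  gsrc_src : forall x, gsrc (gsrc x) = gsrc x;
  grng_src : forall x, grng (gsrc x) = gsrc x;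
  gsrc_rng : forall x, gsrc (grng x) = grng x;
  grng_rng : forall x, grng (grng x) = grng x;
  gsrcM : forall x y, gsrc x = grng y -> gsrc (gmul x y) = gsrc y;
  grngM : forall x y, gsrc x = grng y -> grng (gmul x y) = grng x;
  gmulA : forall x y z, gsrc x = grng y -> gsrc y = grng z ->
    gmul x (gmul y z) = gmul (gmul x y) z;
  gmul_src : forall x, gmul x (gsrc x) = x;
  gmul_rng : forall x, gmul (grng x) x = x;
  gsrcV : forall x, gsrc (ginv x) = grng x;
  grngV : forall x, grng (ginv x) = gsrc x;
  gmulVg : forall x, gmul (ginv x) x = gsrc x;
  gmulgV : forall x, gmul x (ginv x) = grng x
}.

#[short(type="groupoidType")]
HB.structure Definition Groupoid := {G of isGroupoid G & Choice G}.

Definition composable (G : groupoidType) : set (G * G) :=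
  [set xy | gsrc xy.1 = grng xy.2].
Arguments composable : clear implicits.

HB.mixin Record Groupoid_isTopological G of isGroupoid G & Topological G := {
  gmul_continuous :
    {within composable G, continuous (fun xy : G * G => gmul xy.1 xy.2)};
  ginv_continuous : continuous (@ginv G)
}.

#[short(type="topologicalGroupoidType")]
HB.structure Definition TopologicalGroupoid :=
  {G of isGroupoid G & Topological G & Groupoid_isTopological G}.

Definition gunits (G : groupoidType) : set G := range (@gsrc G).
Arguments gunits : clear implicits.

(* The source map with codomain the unit space; for [G] topological, the type
   [gunits G] carries the subspace topology. *)
Definition gsource (G : groupoidType) (x : G) : gunits G :=
  exist _ (gsrc x) (mem_set (imageT (@gsrc G) x)).

Definition local_homeomorphism (X Y : topologicalType) (f : X -> Y) :=
  forall x : X, exists U : set X,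
    [/\ open U, U x, open (f @` U), {within U, continuous f} &
        exists2 g : Y -> X, {within f @` U, continuous g} & {in U, cancel f g}].

HB.mixin Record TopologicalGroupoid_isAmple G of TopologicalGroupoid G := {
  gsource_local_homeomorphism : local_homeomorphism (@gsource G);
  gunits_locally_compact : locally_compact [set: gunits G];
  gunits_totally_disconnected : totally_disconnected [set: gunits G];
  gunits_hausdorff : hausdorff_space (gunits G)
}.

#[short(type="ampleGroupoidType")]
HB.structure Definition AmpleGroupoid :=
  {G of TopologicalGroupoid_isAmple G & TopologicalGroupoid G}.

Definition compact_open_bisection (G : topologicalGroupoidType) (B : set G) :=
  [/\ compact B, open B, set_inj B (@gsrc G) & set_inj B (@grng G)].

Definition gsetM (G : groupoidType) (B C : set G) : set G :=
  [set gmul xy.1 xy.2 | xy in B `*` C `&` composable G].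

Definition bisection_subsemigroup (G : topologicalGroupoidType)
    (calB : set (set G)) :=
  calB `<=` @compact_open_bisection G /\
  forall B C, calB B -> calB C -> calB (gsetM B C).

Section BisectionProduct.
Variable G : ampleGroupoidType.
Implicit Types B C : set G.

Let continuous_within_comp (X Y Z : topologicalType) (A : set Y)
    (g : X -> Y) (h : Y -> Z) (x : X) :
  {within A, continuous h} -> {for x, continuous g} ->
  A (g x) -> (\forall y \near x, A (g y)) -> {for x, continuous (h \o g)}.
Proof.
move=> /subspace_continuousP ch cg Agx nA U /= Uhgx.
have /= V := ch _ Agx U Uhgx.
have {}V : \forall y \near x, A (g y) -> U (h (g y)) := cg _ V.
change (\forall y \near x, U (h (g y))).
by apply: filterS2 nA V => y Ay; exact.
Qed.

Let continuous_pair (X Y Z : topologicalType) (f : X -> Y) (g : X -> Z) (x : X) :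
  {for x, continuous f} -> {for x, continuous g} ->
  {for x, continuous (fun y : X => (f y, g y))}.
Proof. exact: cvg_pair. Qed.

Lemma gmulKV (x y : G) : gsrc x = gsrc y -> gmul (gmul x (ginv y)) y = x.
Proof.
by move=> e; rewrite -gmulA ?grngV ?gsrcV// gmulVg -e gmul_src.
Qed.

Lemma gmulK (x y : G) : gsrc x = grng y -> gmul (gmul x y) (ginv y) = x.
Proof. by move=> e; rewrite -gmulA ?grngV// gmulgV -e gmul_src. Qed.

Lemma gsrc_continuous : continuous (@gsrc G).
Proof.
move=> x; rewrite (_ : @gsrc G =
  (fun xy : G * G => gmul xy.1 xy.2) \o (fun y => (ginv y, y))); last first.
  by apply/funext => y /=; rewrite gmulVg.
apply: (continuous_within_comp (@gmul_continuous G)).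
- by apply: continuous_pair; [exact: ginv_continuous | exact: cvg_id].
- exact: gsrcV.
- by apply: nearW => y; exact: gsrcV.
Qed.

Lemma gsource_continuous : continuous (@gsource G).
Proof.
apply: (@continuous_comp_initial (gunits G) G G set_val).
exact: gsrc_continuous.
Qed.

Lemma gsourceP (x y : G) : gsource x = gsource y <-> gsrc x = gsrc y.
Proof.
split=> [/(congr1 (@sval _ _)) //|e]; exact: eq_exist.
Qed.

Lemma composable_closed : closed (composable G).
Proof.
rewrite -openC openE => -[x y] /= nxy.
have nE : gsource x != gsource (ginv y).
  by apply/eqP => /gsourceP; rewrite gsrcV.
have := @gunits_hausdorff G; rewrite open_hausdorff => /(_ _ _ nE) -[[A B] /= [/set_mem Ax /set_mem By]].
move=> [oA oB /eqP AB0].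
have cA : {for (x, y), continuous (fun xy : G * G => gsource xy.1)}.
  by apply: continuous_comp; [exact: cvg_fst | exact: gsource_continuous].
have cB : {for (x, y), continuous (fun xy : G * G => gsource (ginv xy.2))}.
  apply: continuous_comp; last exact: gsource_continuous.
  by apply: continuous_comp; [exact: cvg_snd|exact: ginv_continuous].
have nA : \forall xy \near (x, y), A (gsource xy.1).
  by apply: cA; exact: open_nbhs_nbhs.
have nB : \forall xy \near (x, y), B (gsource (ginv xy.2)).
  by apply: cB; exact: open_nbhs_nbhs.
change (\forall xy \near (x, y), (~` composable G) xy).
apply: filterS2 nA nB => -[x' y'] /= Ax' By' e.
have : (A `&` B) (gsource x').
  split => //; suff -> : gsource x' = gsource (ginv y') by [].
  by apply/gsourceP; rewrite gsrcV.
by rewrite AB0.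
Qed.

Lemma gsetM_compact B C : compact B -> compact C -> compact (gsetM B C).
Proof.
move=> cB cC; apply: continuous_compact.
  apply: continuous_subspaceW (@gmul_continuous G); exact: subIsetr.
apply: compact_closedI; [exact: compact_setX | exact: composable_closed].
Qed.

Lemma gsetM_open B C : open B -> open C -> open (gsetM B C).
Proof.
move=> oB oC; rewrite openE => _ [[b c] /= [[Bb Cc] e] <-] /=.
rewrite /composable/= in e.
have [U [oU Uc oV _ [k ck kK]]] := gsource_local_homeomorphism c.
pose sigma y := k (gsource y).
have sE : gsource (gmul b c) = gsource c by apply/gsourceP; exact: gsrcM.
have Vbc : (@gsource G @` U) (gsource (gmul b c)) by rewrite sE; exact: imageP.
have sigmabc : sigma (gmul b c) = c by rewrite /sigma sE kK// inE.
have csigma : {for gmul b c, continuous sigma}.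
  apply: continuous_comp; first exact: gsource_continuous.
  by move: ck; rewrite continuous_open_subspace// => /(_ _ (mem_set Vbc)).
have nV : \forall y \near gmul b c, (@gsource G @` U) (gsource y).
  by apply: (@gsource_continuous (gmul b c)); exact: open_nbhs_nbhs.
have compos y : (@gsource G @` U) (gsource y) -> gsrc y = gsrc (sigma y).
  by move=> [u Uu eu]; apply/gsourceP; rewrite /sigma -eu kK// inE.
pose p y : G * G := (y, ginv (sigma y)).
have cm : {for gmul b c, continuous ((fun xy => gmul xy.1 xy.2) \o p)}.
  apply: (continuous_within_comp (@gmul_continuous G)).
  - apply: continuous_pair; first exact: cvg_id.
    by apply: continuous_comp; [exact: csigma|exact: ginv_continuous].
  - by rewrite /composable/= grngV; exact: compos.
  - by move: nV; apply: filterS => y /compos; rewrite /composable/= grngV.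
have nB : \forall y \near gmul b c, B (gmul y (ginv (sigma y))).
  apply: cm; apply: open_nbhs_nbhs; split => //=.
  by rewrite sigmabc gmulK.
have nC : \forall y \near gmul b c, C (sigma y).
  by apply: csigma; apply: open_nbhs_nbhs; split => //; rewrite sigmabc.
have {}nV : \forall y \near gmul b c, gsrc y = gsrc (sigma y).
  by apply: filterS nV => y /compos.
change (\forall y \near gmul b c, gsetM B C y).
apply: filterS3 nV nB nC => y sy By Cy.
exists (gmul y (ginv (sigma y)), sigma y) => /=; last exact: gmulKV.
by split; last rewrite /composable/= gsrcM ?grngV// gsrcV.
Qed.

Lemma gsetM_bisection B C :
  compact_open_bisection B -> compact_open_bisection C ->
  compact_open_bisection (gsetM B C).
Proof.
move=> [cB oB sB rB] [cC oC sC rC]; split.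
- exact: gsetM_compact.
- exact: gsetM_open.
- move=> x y /set_mem[[b c] /= [[Bb Cc] /= e] <-{x}].
  move=> /set_mem[[b' c'] /= [[Bb' Cc'] /= e'] <-{y}].
  rewrite !gsrcM// => /(sC _ _ (mem_set Cc) (mem_set Cc')) ec; subst c'.
  by rewrite (sB _ _ (mem_set Bb) (mem_set Bb'))// e e'.
- move=> x y /set_mem[[b c] /= [[Bb Cc] /= e] <-{x}].
  move=> /set_mem[[b' c'] /= [[Bb' Cc'] /= e'] <-{y}].
  rewrite !grngM// => /(rB _ _ (mem_set Bb) (mem_set Bb')) ec; subst b'.
  by rewrite (rC _ _ (mem_set Cc) (mem_set Cc'))// -e -e'.
Qed.

End BisectionProduct.

HB.mixin Record Lmodule_isNonUnitalAlgebra (R : comPzRingType) A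
    of GRing.Lmodule R A := {
  numul : A -> A -> A;
  numulA : associative numul;
  numulDl : left_distributive numul +%R;
  numulDr : right_distributive numul +%R;
  numulZl : forall (a : R) x y, numul (a *: x) y = a *: numul x y;
  numulZr : forall (a : R) x y, numul x (a *: y) = a *: numul x y
}.

#[short(type="nonUnitalAlgType")]
HB.structure Definition NonUnitalAlgebra (R : comPzRingType) :=
  {A of GRing.Lmodule R A & Lmodule_isNonUnitalAlgebra R A}.

Definition algebra_hom (R : comPzRingType) (A Q : nonUnitalAlgType R)
    (f : A -> Q) := linear f /\ {morph f : x y / numul x y}.

Section LinearSpan.
Variables (R : pzRingType) (V : lmodType R).

Definition lspan (S : set V) : set V :=
  [set v | exists2 s : seq (R * V),
    {in s, forall p, S p.2} & v = \sum_(p <- s) p.1 *: p.2].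

Lemma lspan0 (S : set V) : lspan S 0.
Proof. by exists [::]; rewrite ?big_nil. Qed.

Lemma lspanD (S : set V) a u v :
  lspan S u -> lspan S v -> lspan S (a *: u + v).
Proof.
move=> [su suS ->] [sv svS ->].
exists ([seq (a * p.1, p.2) | p <- su] ++ sv).
  by move=> p; rewrite mem_cat => /orP[/mapP[q /suS Sq ->]|/svS].
rewrite big_cat big_map /= scaler_sumr; congr (_ + _).
by apply: eq_bigr => p _; rewrite scalerA.
Qed.

Lemma lspan_gen (S : set V) v : S v -> lspan S v.
Proof.
move=> Sv; exists [:: (1, v)]; last by rewrite big_seq1 scale1r.
by move=> p; rewrite inE => /eqP ->.
Qed.

Lemma lspan_ind (S P : set V) : P 0 ->
  (forall a e v, S e -> lspan S v -> P v -> P (a *: e + v)) -> lspan S `<=` P.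
Proof.
move=> P0 PD _ [s sS ->].
suff [] : lspan S (\sum_(p <- s) p.1 *: p.2) /\ P (\sum_(p <- s) p.1 *: p.2) by [].
elim: s sS => [|[a e] s IH] sS; first by rewrite big_nil; split=> //; exact: lspan0.
rewrite big_cons /=.
have Se : S e by apply: (sS (a, e)); rewrite mem_head.
have [|Ls Ps] := IH; first by move=> p ps; apply: sS; rewrite inE ps orbT.
by split; [apply: lspanD => //; exact: lspan_gen|exact: PD].
Qed.

End LinearSpan.

(* For [f], [g] in the Steinberg algebra the sum has finitely many nonzero
   terms (see [steinberg_fun_fin]); [\sum_(_ \in _)] is the sum over the
   support of the summand. *)
Definition convolution (R : pzRingType) (G : groupoidType)
    (f g : G -> R) : G -> R :=
  fun x => \sum_(y \in [set y | gsrc y = gsrc x]) f (gmul x (ginv y)) * g y.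

Section Convolution.
Variables (R : comPzRingType) (G : ampleGroupoidType).
Local Notation cob := (@compact_open_bisection G).
Local Notation conv := (@convolution R G).

Definition steinberg_fun : set (G -> R^o) := @lspan R (G -> R^o) [set \1_B | B in cob].

Let fctDZ (a : R) (f g : G -> R^o) (y : G) : (a *: f + g) y = a * f y + g y.
Proof. by []. Qed.

Lemma steinberg_fun_fin f : steinberg_fun f ->
  forall x : G, finite_set [set y | gsrc y = gsrc x /\ f y != 0].
Proof.
move: f; apply: lspan_ind => [x|a _ v [B [_ _ sB _] <-] _ IH x].
  by rewrite (_ : mkset _ = set0)// -subset0 => y /= [_]; rewrite eqxx.
apply: (@sub_finite_set _ _
    ((B `&` [set y | gsrc y = gsrc x]) `|` [set y | gsrc y = gsrc x /\ v y != 0])).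
  move=> y /= [yx nz]; have [By|nBy] := pselect (B y); first by left.
  right; split=> //; apply: contra nz => /eqP vy.
  by rewrite fctDZ indicE memNset// vy addr0 mulr0.
rewrite finite_setU; split=> //.
have [[y [By yx]]|e0] := pselect ((B `&` [set y | gsrc y = gsrc x]) !=set0).
  apply: (@sub_finite_set _ _ [set y]) => // z [Bz zx] /=.
  by apply: sB; rewrite ?inE// zx yx.
by move/set0P/negP: e0; rewrite negbK => /eqP ->.
Qed.

Lemma convolutionE (f g : G -> R) (D : set G) (x : G) : finite_set D ->
  D `<=` [set y | gsrc y = gsrc x] ->
  (forall y, gsrc y = gsrc x -> g y != 0 -> D y) ->
  conv f g x = \sum_(y <- fset_set D) f (gmul x (ginv y)) * g y.
Proof.
move=> finD Dx Dg; rewrite -fsbig_finite//; apply/esym/fsbig_widen => //.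
move=> y [/= yx nDy]; apply/eqP; apply: contra_notT nDy => nz.
by apply: Dg => //; apply: contra nz => /eqP ->; rewrite mulr0.
Qed.

Lemma conv0l f : conv 0 f = 0.
Proof. by apply/funext => x; apply: fsbig1 => y _; rewrite mul0r. Qed.

Lemma conv0r f : conv f 0 = 0.
Proof. by apply/funext => x; apply: fsbig1 => y _; rewrite mulr0. Qed.

Lemma convDl a (f f' g : G -> R^o) : steinberg_fun g ->
  conv (a *: f + f') g = a *: (conv f g : G -> R^o) + conv f' g.
Proof.
move=> /steinberg_fun_fin gF; apply/funext => x.
pose D := [set y | gsrc y = gsrc x /\ g y != 0].
have DE h : conv h g x = \sum_(y <- fset_set D) h (gmul x (ginv y)) * g y.
  by apply: convolutionE; [exact: gF|move=> y []|].
rewrite !fctDZ !DE mulr_sumr -big_split /=; apply: eq_bigr => y _.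
by rewrite fctDZ mulrDl -mulrA.
Qed.

Lemma convDr a (f g g' : G -> R^o) : steinberg_fun g -> steinberg_fun g' ->
  conv f (a *: g + g') = a *: (conv f g : G -> R^o) + conv f g'.
Proof.
move=> /steinberg_fun_fin gF /steinberg_fun_fin gF'; apply/funext => x.
pose D := [set y | gsrc y = gsrc x /\ g y != 0] `|`
          [set y | gsrc y = gsrc x /\ g' y != 0].
have finD : finite_set D by rewrite finite_setU; split; [exact: gF|exact: gF'].
have DE h : (forall y, h y != 0 -> g y != 0 \/ g' y != 0) ->
    conv f h x = \sum_(y <- fset_set D) f (gmul x (ginv y)) * h y.
  move=> hD; apply: convolutionE => // [y [] [] //|y yx /hD[]]; by [left|right].
rewrite !fctDZ !DE; last 3 first.
- by right.
- by left.
- move=> y; have [gy0|] := eqVneq (g y) 0; last by left.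
  move=> nz; right; apply: contra nz => /eqP g'y.
  by rewrite fctDZ g'y gy0 mulr0 addr0.
rewrite mulr_sumr -big_split /=; apply: eq_bigr => y _.
by rewrite fctDZ mulrDr mulrCA.
Qed.

Lemma conv_indic B C : cob B -> cob C -> conv \1_B \1_C = \1_(gsetM B C).
Proof.
move=> [_ _ _ _] [_ _ sC _]; apply/funext => x; rewrite indicE /convolution.
have [|nx] := pselect (gsetM B C x).
  move=> xBC; rewrite mem_set//.
  case: xBC => -[b c] /= [[Bb Cc] bc] <-.
  rewrite -(fsbig_widen [set c]); last 2 first.
  - by move=> _ /= ->; rewrite gsrcM.
  - move=> y [/= ey yc]; rewrite !indicE [y \in C]memNset ?mulr0// => Cy.
    by apply: yc; apply: sC; rewrite ?inE// ey gsrcM.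
  by rewrite fsbig_set1 !indicE gmulK// !mem_set// mulr1.
rewrite memNset//; apply: fsbig1 => y /= yx; rewrite !indicE.
have [Cy|nCy] := pselect (C y); last by rewrite [y \in C]memNset ?mulr0.
rewrite memNset ?mul0r// => Bxy; apply: nx.
exists (gmul x (ginv y), y) => /=; last exact: gmulKV.
by split => //; rewrite /composable/= gsrcM ?grngV ?gsrcV.
Qed.

Lemma gsetMA (B C D : set G) : gsetM B (gsetM C D) = gsetM (gsetM B C) D.
Proof.
apply/seteqP; split=> x.
  move=> [[b _] /= [[Bb [[c d] /= [[Cc Dd] cd] <-]] b_cd] <-].
  have bc : gsrc b = grng c by rewrite [LHS]b_cd /= grngM.
  exists (gmul b c, d) => /=; last by rewrite gmulA.
  split; last by rewrite /composable/= gsrcM.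
  by split=> //=; exists (b, c).
move=> [[_ d] /= [[[[b c] /= [[Bb Cc] bc] <-] Dd] bc_d] <-].
have cd : gsrc c = grng d by rewrite -[RHS]bc_d /= gsrcM.
exists (b, gmul c d) => /=; last by rewrite gmulA.
split; last by rewrite /composable/= grngM.
by split=> //=; exists (c, d).
Qed.

Lemma steinberg_funM f g :
  steinberg_fun f -> steinberg_fun g -> steinberg_fun (conv f g).
Proof.
move=> + Ag; move: f; apply: lspan_ind => [|a _ f [B cB <-] _ IH].
  by rewrite conv0l; exact: lspan0.
rewrite convDl//; apply: lspanD => // {IH}.
move: g Ag; apply: lspan_ind => [|c _ g [C cC <-] Ag IH].
  by rewrite conv0r; exact: lspan0.
have AC : steinberg_fun \1_C by apply: lspan_gen; exists C.
rewrite convDr//; apply: lspanD => //.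
rewrite conv_indic//; apply: lspan_gen; exists (gsetM B C) => //.
exact: gsetM_bisection.
Qed.

Lemma convA f g h : steinberg_fun f -> steinberg_fun g -> steinberg_fun h ->
  conv f (conv g h) = conv (conv f g) h.
Proof.
have gen B : cob B -> steinberg_fun \1_B by move=> cB; apply: lspan_gen; exists B.
move=> + Ag Ah; move: f; apply: lspan_ind => [|a _ f [B cB <-] Af IH].
  by rewrite !conv0l.
have AB := gen _ cB.
rewrite !convDl ?IH//; last exact: steinberg_funM.
suff -> : conv \1_B (conv g h) = conv (conv \1_B g) h by []; move=> {IH}.
move: g Ag; apply: lspan_ind => [|c _ g [C cC <-] Ag IH].
  by rewrite conv0l conv0r conv0l.
have AC := gen _ cC.
rewrite convDl// !convDr ?convDl ?IH//; try exact: steinberg_funM.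
suff -> : conv \1_B (conv \1_C h) = conv (conv \1_B \1_C) h by []; move=> {IH}.
move: h Ah; apply: lspan_ind => [|d _ h [D cD <-] Ah IH].
  by rewrite !conv0r.
have AD := gen _ cD.
rewrite !convDr ?IH//; try exact: steinberg_funM.
by rewrite !conv_indic ?gsetMA//; exact: gsetM_bisection.
Qed.

Record steinberg := Steinberg {
  steinberg_val :> G -> R^o;
  _ : steinberg_val \in steinberg_fun
}.

HB.instance Definition _ := [isSub for steinberg_val].
HB.instance Definition _ := [Choice of steinberg by <:].

Lemma steinberg_fun_closed :
  subsemimod_closed (fun f : G -> R^o => f \in steinberg_fun).
Proof.
split; first split.
- by rewrite inE; exact: lspan0.
- move=> f g; rewrite !inE -[f in f + _]scale1r; exact: lspanD.
- move=> a f; rewrite !inE -[_ *: _]addr0 => ?; apply: lspanD => //; exact: lspan0.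
Qed.

HB.instance Definition _ :=
  GRing.SubChoice_isSubLmodule.Build R (G -> R^o) _ steinberg
    steinberg_fun_closed.

Lemma steinbergP (f : steinberg) : steinberg_fun f.
Proof. exact: set_mem (valP f). Qed.

Definition steinberg_mul (f g : steinberg) : steinberg :=
  Steinberg (mem_set (steinberg_funM (steinbergP f) (steinbergP g))).

Fact steinberg_mulA : associative steinberg_mul.
Proof.
by move=> f g h; apply: val_inj; apply: convA; exact: steinbergP.
Qed.

Fact steinberg_mulDl : left_distributive steinberg_mul +%R.
Proof.
move=> f g h; apply: val_inj => /=.
rewrite -[val f in LHS]scale1r convDl ?scale1r//; exact: steinbergP.
Qed.

Fact steinberg_mulDr : right_distributive steinberg_mul +%R.
Proof.
move=> f g h; apply: val_inj => /=.
rewrite -[val g in LHS]scale1r convDr ?scale1r//; exact: steinbergP.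
Qed.

Fact steinberg_mulZl (a : R) f g :
  steinberg_mul (a *: f) g = a *: steinberg_mul f g.
Proof.
apply: val_inj => /=; rewrite -[_ *: val f]addr0 convDl; last exact: steinbergP.
by rewrite conv0l addr0.
Qed.

Fact steinberg_mulZr (a : R) f g :
  steinberg_mul f (a *: g) = a *: steinberg_mul f g.
Proof.
apply: val_inj => /=; rewrite -[_ *: val g]addr0 convDr; last exact: lspan0.
  by rewrite conv0r addr0.
exact: steinbergP.
Qed.

HB.instance Definition _ := Lmodule_isNonUnitalAlgebra.Build R steinberg
  steinberg_mulA steinberg_mulDl steinberg_mulDr steinberg_mulZl steinberg_mulZr.

(* Equal to the default value [0] only when [B] is not a compact open
   bisection, see [steinberg_indicE]. *)
Definition steinberg_indic (B : set G) : steinberg :=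
  insubd (0 : steinberg) (\1_B : G -> R^o).

Lemma steinberg_indicE (B : set G) :
  cob B -> val (steinberg_indic B) = \1_B.
Proof.
by move=> cB; rewrite insubdK// inE; apply: lspan_gen; exists B.
Qed.

End Convolution.

(* The family is given by a function on all sets of which only the values on
   [calB] matter. *)
Definition bisection_representation (R : comPzRingType) (G : groupoidType)
    (calB : set (set G)) (Q : nonUnitalAlgType R) (t : set G -> Q) :=
  [/\ calB set0 -> t set0 = 0,
      forall A B, calB A -> calB B -> numul (t A) (t B) = t (gsetM A B) &
      forall F : set (set G), finite_set F -> F `<=` calB ->
        calB (\bigcup_(B in F) B) -> trivIset F id ->
        \sum_(B \in F) t B = t (\bigcup_(B in F) B)].

(* Main.v *)
(* Given a representation [t], set [pi (\sum_i r_i 1_{B_i}) := \sum_i r_i t_{B_i}];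
   everything hinges on this being well defined, i.e. on [\sum_i r_i 1_{B_i} = 0]
   implying [\sum_i r_i t_{B_i} = 0].  Instead of a common refinement of the
   [B_i], one covers them by disjoint members [A] of [calB] and works on each [A]
   separately, cutting [A] along one [B_i] at a time: on the pieces inside [B_i]
   that term becomes a constant, on the others it vanishes.  Multiplicativity is
   then (R2) and bilinearity, and the [1_B] with [B] in [calB] span because a
   compact open bisection is a finite disjoint union of members of [calB]. *)
Require Import Defs.
From HB Require Import structures.
From mathcomp Require Import all_boot all_algebra finmap.
From mathcomp Require Import all_classical.
From mathcomp Require Import topology measurable_structure.
From mathcomp Require Import numfun.

Set Implicit Arguments.
Unset Strict Implicit.
Unset Printing Implicit Defensive.
Import GRing.Theory.
Local Open Scope classical_set_scope.
Local Open Scope ring_scope.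

(** * Compact open sets and bases *)

Lemma compact_open_basis (T : topologicalType) (B : set (set T)) (U : set T) :
  basis B -> compact U -> open U ->
  exists2 s : seq (set T), {in s, forall A, B A} & U = \bigcup_(A in [set` s]) A.
Proof.
move=> [Bopen Bnbhs] cU oU.
have [U0|/set0P[x0 Ux0]] := eqVneq U set0.
  by exists [::] => //; rewrite bigcup_seq big_nil.
(* The cover form of compactness is applied in a pointed space, with a point of the nonempty set [U]
   as base point. *)
pose X : ptopologicalType :=
  HB.pack (T : Type) (Topological.on T) (isPointed.Build T x0).
have : @cover_compact X U by rewrite -compact_cover.
(* Only basic sets contained in [U] enter the cover, so a finite subcover has union exactly [U]. *)
move=> /(_ _ [set A | B A /\ A `<=` U] id)[A [/Bopen]//||s sB Us].
  move=> x Ux; have [A [BA Ax] AU] : filter_from [set A | B A /\ A x] id U.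
    by apply: Bnbhs; exact: open_nbhs_nbhs.
  by exists A.
exists (finmap.enum_fset s) => [A /sB|]; first by rewrite inE => -[].
by apply/seteqP; split => // x [A /= /sB]; rewrite inE => -[_ AU] /AU.
Qed.

(** * Semirings of sets: disjoint families and partitions *)

Section Semiring.
Variables (T : Type) (S : set (set T)).
Hypothesis SD : semi_setD_closed S.

(** Induction on the list: the new set [B] is kept whole and is cut out of each piece found so far,
    what remains of a piece being a disjoint union of members of [S]. *)
Lemma bigcup_disjoint_refinement (s : seq (set T)) : {in s, forall A, S A} ->
  exists E : set (set T), [/\ finite_set E, E `<=` S, trivIset E id &
    \bigcup_(A in E) A = \bigcup_(A in [set` s]) A].
Proof.
elim: s => [|B s IH] sS.
  by exists set0; split; rewrite ?bigcup_set0 ?bigcup_seq ?big_nil.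
have SB : S B by apply: sS; rewrite mem_head.
have [|E [finE ES tE EU]] := IH; first by move=> A As; apply: sS; rewrite inE As orbT.
have /choice[D DP] : forall A, exists D : set (set T), E A ->
    [/\ finite_set D, D `<=` S, A `\` B = \bigcup_(X in D) X & trivIset D id].
  by move=> A; have [/ES/SD/(_ SB)[D DP]|nEA] := pselect (E A); [exists D|exists set0].
have sub A C x : E A -> D A C -> C x -> A x /\ ~ B x.
  by move=> EA DC Cx; have [_ _ e _] := DP _ EA; suff : (A `\` B) x by []; rewrite e; exists C.
exists (B |` \bigcup_(A in E) D A); split.
- rewrite finite_setU; split; first exact: finite_set1.
  by apply: bigcup_finite => // A /DP[].
- by move=> C [-> //|[A EA] DC]; have [_ + _ _] := DP _ EA; exact.
- move=> C C' [->|[A EA DC]] [->|[A' EA' DC']] [x [Cx C'x]] //.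
  + by have [] := sub _ _ _ EA' DC' C'x.
  + by have [] := sub _ _ _ EA DC Cx.
  + have [Ax _] := sub _ _ _ EA DC Cx; have [A'x _] := sub _ _ _ EA' DC' C'x.
    have AA' : A = A' by apply: tE => //; exists x.
    by subst A'; have [_ _ _] := DP _ EA; apply => //; exists x.
- rewrite bigcup_setU1 bigcup_seq big_cons -bigcup_seq -EU; apply/seteqP; split => x.
    move=> [Bx|[C [A EA DC] Cx]]; first by left.
    by right; exists A => //; have [] := sub _ _ _ EA DC Cx.
  move=> [Bx|[A EA Ax]]; first by left.
  have [Bx|nBx] := pselect (B x); first by left.
  have [_ _ e _] := DP _ EA.
  have : (A `\` B) x by [].
  by rewrite e => -[C DC Cx]; right; exists C => //; exists A.
Qed.

Hypothesis SI : setI_closed S.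

Lemma setI_setD_partition (A B : set T) : S A -> S B ->
  exists E : set (set T), [/\ finite_set E, E `<=` S, trivIset E id,
    \bigcup_(C in E) C = A &
    forall C, E C -> C `<=` B \/ C `&` B = set0].
Proof.
move=> SA SB; have [D [finD DS ABD tD]] := SD SA SB.
have sub C x : D C -> C x -> A x /\ ~ B x.
  by move=> DC Cx; suff : (A `\` B) x by []; rewrite ABD; exists C.
exists ((A `&` B) |` D); split.
- by rewrite finite_setU; split => //; exact: finite_set1.
- by move=> C [->|/DS//]; exact: SI.
- move=> C C' [->|DC] [->|DC'] [x [/= Cx C'x]] //.
  + by case: Cx => _ Bx; have [] := sub _ _ DC' C'x.
  + by case: C'x => _ Bx; have [] := sub _ _ DC Cx.
  + by apply: tD => //; exists x.
- by rewrite bigcup_setU1 -ABD setUIDK.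
- move=> C [->|DC]; first by left; exact: subIsetr.
  right; apply/seteqP; split => // x [Cx Bx].
  by have [] := sub _ _ DC Cx.
Qed.

(** * Finitely additive functions on a semiring *)

Variables (R : pzRingType) (V : lmodType R) (t : set T -> V).
Hypotheses (S0 : S set0) (t0 : t set0 = 0).
Hypothesis tU : forall F : set (set T), finite_set F -> F `<=` S ->
  S (\bigcup_(B in F) B) -> trivIset F id ->
  \sum_(B \in F) t B = t (\bigcup_(B in F) B).

Lemma additive_setI (E : set (set T)) (X : set T) :
  finite_set E -> E `<=` S -> trivIset E id ->
  S X -> X `<=` \bigcup_(C in E) C ->
  t X = \sum_(C <- fset_set E) t (X `&` C).
Proof.
move=> finE ES tE SX XE.
have tE' D : D `<=` E -> trivIset D (fun C => X `&` C).
  by move=> DE; apply: trivIset_setIl; exact: (sub_trivIset DE).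
(* Several [C] may miss [X]. Keeping only nonempty traces makes the map from [C] to its trace on [X]
   injective, and the dropped ones contribute [t set0 = 0]. *)
pose D := E `&` [set C | X `&` C != set0].
have finD : finite_set D by exact: finite_setIl.
have XU : \bigcup_(B in (fun C => X `&` C) @` D) B = X.
  rewrite bigcup_image -setI_bigcupr; apply/setIidPl => x Xx.
  have [C EC Cx] := XE _ Xx; exists C => //; split => //=.
  by apply/set0P; exists x.
rewrite -[in LHS]XU -tU.
- rewrite fsbig_image; last first.
    move=> C C' /set_mem[EC /set0P[x [Xx Cx]]] /set_mem[EC' _] e.
    apply: tE => //; exists x; split => //.
    by have [] : (X `&` C') x by rewrite -e.
  rewrite -fsbig_finite//; apply: fsbig_widen; first exact: subIsetl.
  by move=> C [EC /= nD]; have [-> //|XC] := eqVneq (X `&` C) set0; case: nD.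
- exact: finite_image.
- by move=> _ [C [/ES SC _] <-]; exact: SI.
- by rewrite XU.
- by apply: trivIset_image; apply: tE'; exact: subIsetl.
Qed.

(* The constant [c] absorbs the terms already known to be constant on [A], which
   is what lets the induction on [s] go through. *)
Lemma additive_local_eq0 (s : seq (R * set T)) (c : R) (A : set T) :
  {in s, forall p, S p.2} -> S A ->
  (forall x, A x -> c + \sum_(p <- s) p.1 * \1_(p.2) x = 0) ->
  c *: t A + \sum_(p <- s) p.1 *: t (p.2 `&` A) = 0.
Proof.
elim: s c A => [|[r B] s IH] c A sS SA.
  rewrite !big_nil !addr0 => c0.
  (* With no terms left, a point of [A] forces [c = 0]; if there is none, [t A] is zero. *)
  have [->|/set0P[x /c0]] := eqVneq A set0; first by rewrite t0 scaler0.
  by rewrite big_nil addr0 => ->; rewrite scale0r.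
move=> cA.
have SB : S B by apply: (sS (r, B)); rewrite mem_head.
have {}sS : {in s, forall p, S p.2} by move=> p ps; apply: sS; rewrite inE ps orbT.
have [E [finE ES tE EA EB]] := setI_setD_partition SA SB.
have tI X : S X -> t (X `&` A) = \sum_(C <- fset_set E) t (X `&` C).
  move=> SX; rewrite (additive_setI finE)//; last by rewrite EA; exact: subIsetr.
    apply: eq_big_seq => C; rewrite in_fset_set// => /set_mem EC.
    congr t; rewrite -setIA; congr (_ `&` _); apply/setIidPr.
    by rewrite -EA => x Cx; exists C.
  exact: SI.
have tA : t A = \sum_(C <- fset_set E) t C.
  rewrite -[A in LHS]setIid tI//; apply: eq_big_seq => C.
  rewrite in_fset_set// => /set_mem EC; congr t; apply/setIidPr.
  by rewrite -EA => x Cx; exists C.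
(* Every term is expanded over the pieces of [A] and the sums are exchanged, so that each piece [C]
   can be shown to contribute zero. *)
rewrite big_cons /= tA tI// scaler_sumr scaler_sumr.
under [X in _ + (_ + X)]eq_big_seq => p ps.
  rewrite tI; [rewrite scaler_sumr; over|exact: sS].
rewrite exchange_big -!big_split /= big_seq big1// => C.
rewrite in_fset_set// => /set_mem EC.
have CA : C `<=` A by move=> x Cx; rewrite -EA; exists C.
have SC := ES _ EC.
(* Inside [B] the coefficient [r] joins the constant; off [B] its term disappears. Either way the
   induction hypothesis applies to [C]. *)
have [CB|CB] := EB _ EC.
  have -> : B `&` C = C by exact/setIidPr.
  rewrite addrA -scalerDl; apply: IH => // x Cx.
  have := cA _ (CA _ Cx); rewrite big_cons /= indicE mem_set ?mulr1 ?addrA//.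
  exact: CB.
rewrite setIC CB t0 scaler0 add0r; apply: IH => // x Cx.
have := cA _ (CA _ Cx); rewrite big_cons /= indicE memNset ?mulr0 ?add0r//.
by move=> Bx; have : (C `&` B) x by []; rewrite CB.
Qed.

(** This is what makes the homomorphism well defined. Each [t p.2] splits over one disjoint family
    covering all the sets involved, and the total over each member of that family vanishes. *)
Lemma additive_sum_eq0 (s : seq (R * set T)) : {in s, forall p, S p.2} ->
  (forall x, \sum_(p <- s) p.1 * \1_(p.2) x = 0) ->
  \sum_(p <- s) p.1 *: t p.2 = 0.
Proof.
move=> sS s0; have [|E [finE ES tE EU]] :=
  @bigcup_disjoint_refinement [seq p.2 | p <- s].
  by move=> _ /mapP[p /sS + ->].
under eq_big_seq => p ps.
  rewrite (additive_setI finE ES tE (sS _ ps)).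
    rewrite scaler_sumr; over.
  by rewrite EU => x px; exists p.2 => //=; exact: map_f.
rewrite exchange_big big_seq big1//= => C.
rewrite in_fset_set// => /set_mem EC.
(* A zero multiple of [t C] is inserted to play the role of the constant [c = 0]. *)
rewrite -[LHS]add0r -[X in X + _](scale0r (t C)).
by apply: additive_local_eq0 => // [|x _]; [exact: ES|rewrite s0 addr0].
Qed.

End Semiring.

(** A point of the union lies in exactly one member of [F], so one term is [1] and the others are
    zero. *)
Lemma indic_bigcup_trivIset (R : pzRingType) (T : Type) (F : set (set T)) (x : T) :
  finite_set F -> trivIset F id ->
  \1_(\bigcup_(B in F) B) x = \sum_(B <- fset_set F) \1_B x :> R.
Proof.
move=> finF tF; rewrite -fsbig_finite//.
have [[B FB Bx]|nx] := pselect ((\bigcup_(B in F) B) x).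
  rewrite indicE mem_set; last by exists B.
  rewrite -(fsbig_widen [set B]); last 2 first.
  - by move=> _ ->.
  - move=> C [FC /= CB]; rewrite indicE memNset// => Cx.
    by apply: CB; apply: tF => //; exists x.
  by rewrite fsbig_set1 indicE mem_set.
rewrite indicE memNset// fsbig1// => B FB.
by rewrite indicE memNset// => Bx; apply: nx; exists B.
Qed.

(** * Sums in non-unital algebras and formal linear combinations *)

Section NonUnitalAlgebraSums.
Variables (R : comPzRingType) (A : nonUnitalAlgType R).
Implicit Types x y : A.

Lemma numul0r x : numul (0 : A) x = 0.
Proof. by rewrite -[in LHS](scale0r (0 : A)) numulZl scale0r. Qed.

Lemma numulr0 x : numul x (0 : A) = 0.
Proof. by rewrite -[in LHS](scale0r (0 : A)) numulZr scale0r. Qed.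

Lemma numul_suml (I : Type) (r : seq I) (F : I -> A) x :
  numul (\sum_(i <- r) F i) x = \sum_(i <- r) numul (F i) x.
Proof.
exact: (big_morph (fun y => numul y x) (fun y z => numulDl y z x) (numul0r x)).
Qed.

Lemma numul_sumr (I : Type) (r : seq I) (F : I -> A) x :
  numul x (\sum_(i <- r) F i) = \sum_(i <- r) numul x (F i).
Proof.
exact: (big_morph (numul x) (numulDr x) (numulr0 x)).
Qed.

End NonUnitalAlgebraSums.

Section LinearCombination.
Variables (R : comPzRingType) (I : Type) (V : lmodType R) (t : I -> V).
Implicit Types (a : R) (s : seq (R * I)).

(** The list is a formal combination. It can be evaluated both at characteristic functions and at a
    representation, so the homomorphism is defined on lists and then shown not to depend on the
    list. *)
Definition lcomb s : V := \sum_(p <- s) p.1 *: t p.2.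

Definition scale_terms a s := [seq (a * p.1, p.2) | p <- s].

Lemma lcomb_cat s s' : lcomb (s ++ s') = lcomb s + lcomb s'.
Proof. exact: big_cat. Qed.

Lemma lcomb_scale a s : lcomb (scale_terms a s) = a *: lcomb s.
Proof.
by rewrite /lcomb big_map scaler_sumr; apply: eq_bigr => p _; rewrite scalerA.
Qed.

End LinearCombination.

Section Multiplication.
Variables (R : comPzRingType) (G : groupoidType).
Implicit Types (s : seq (R * set G)).

(** This is the product of the semigroup algebra, on formal combinations. *)
Definition mul_terms s s' :=
  [seq (p.1 * q.1, gsetM p.2 q.2) | p <- s, q <- s'].

Lemma lcomb_mul (calB : set (set G)) (Q : nonUnitalAlgType R) (t : set G -> Q)
    s s' :
  (forall A B, calB A -> calB B -> numul (t A) (t B) = t (gsetM A B)) ->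
  {in s, forall p, calB p.2} -> {in s', forall p, calB p.2} ->
  lcomb t (mul_terms s s') = numul (lcomb t s) (lcomb t s').
Proof.
move=> tM sB s'B; rewrite /lcomb big_allpairs_dep numul_suml /=.
apply: eq_big_seq => p /sB pB; rewrite numul_sumr.
by apply: eq_big_seq => q /s'B qB; rewrite numulZl numulZr scalerA tM.
Qed.

End Multiplication.

(** * Spanning and the universal property of the Steinberg algebra *)

Section SteinbergUniversal.
Variables (R : comPzRingType) (G : ampleGroupoidType) (calB : set (set G)).
Hypotheses (calB_semigroup : bisection_subsemigroup calB).
Hypotheses (calB_set0 : calB set0) (calB_setI : setI_closed calB).
Hypothesis calB_setD : semi_setD_closed calB.

Let indic := @steinberg_indic R G.

Let calB_cob B : calB B -> compact_open_bisection B.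
Proof. by case: calB_semigroup => + _; exact. Qed.

Let in_terms (s : seq (R * set G)) := {in s, forall p, calB p.2}.

Lemma lcomb_indicE (s : seq (R * set G)) (x : G) :
  {in s, forall p, compact_open_bisection p.2} ->
  val (lcomb indic s) x = \sum_(p <- s) p.1 * \1_(p.2) x.
Proof.
move=> sB; rewrite raddf_sum fct_sumE; apply: eq_big_seq => p /sB pB.
by rewrite [LHS](_ : _ = p.1 * val (indic p.2) x)// steinberg_indicE.
Qed.

Lemma steinberg_indic_bigcup (F : set (set G)) :
  finite_set F -> F `<=` @compact_open_bisection G -> trivIset F id ->
  compact_open_bisection (\bigcup_(B in F) B) ->
  \sum_(B <- fset_set F) indic B = indic (\bigcup_(B in F) B).
Proof.
move=> finF FB tF FU; apply: val_inj; apply/funext => x.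
rewrite steinberg_indicE// indic_bigcup_trivIset// raddf_sum fct_sumE.
apply: eq_big_seq => B; rewrite in_fset_set// => /set_mem/FB BB.
by rewrite -[LHS]/(val (indic B) x) steinberg_indicE.
Qed.

(** (R2) is the formula for the convolution of two characteristic functions of bisections; (R3)
    holds pointwise by disjointness. *)
Lemma steinberg_indic_representation : bisection_representation calB indic.
Proof.
split.
- move=> _; apply: val_inj; rewrite steinberg_indicE; last exact: calB_cob.
  by apply/funext => x; rewrite indicE in_set0.
- move=> A B /calB_cob cA /calB_cob cB; apply: val_inj.
  rewrite steinberg_indicE; last exact: gsetM_bisection.
  by rewrite -conv_indic//= !steinberg_indicE.
- move=> F finF FB FU tF; rewrite fsbig_finite// steinberg_indic_bigcup//.
    by move=> B /FB/calB_cob.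
  exact: calB_cob.
Qed.

(** By induction over the span, only the characteristic function of an arbitrary compact open
    bisection matters. The bisection is a finite union of basic sets, which can be made disjoint
    within [calB]. *)
Lemma steinberg_lcomb (f : steinberg R G) : basis calB ->
  exists2 s, in_terms s & f = lcomb indic s.
Proof.
move=> calB_basis.
suff [s sB fs] : exists2 s, in_terms s & val f = val (lcomb indic s).
  by exists s => //; exact: val_inj.
pose P (g : G -> R^o) := exists2 s, in_terms s & g = val (lcomb indic s).
apply: (@lspan_ind R (G -> R^o) _ P _ _ _ (steinbergP f)) => [|a _ v [B cB <-] _ [s sB ->]].
  by exists [::] => //; rewrite /lcomb big_nil.
have [Bc Bo _ _] := cB.
have [r rB BU] := compact_open_basis calB_basis Bc Bo.
have [E [finE EB tE EU]] := bigcup_disjoint_refinement calB_setD rB.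
exists (scale_terms a [seq (1, C) | C <- fset_set E] ++ s).
  move=> p; rewrite mem_cat => /orP[|/sB//].
  move=> /mapP[_ /mapP[C + ->] ->] /=.
  by rewrite in_fset_set// => /set_mem/EB.
rewrite lcomb_cat lcomb_scale /lcomb big_map.
under eq_bigr do rewrite scale1r.
rewrite steinberg_indic_bigcup// ?EU -?BU//; last by move=> C /EB/calB_cob.
by rewrite -steinberg_indicE.
Qed.

Lemma lspan_steinberg_indic : basis calB ->
  lspan [set indic B | B in calB] = [set: steinberg R G].
Proof.
move=> calB_basis; apply/seteqP; split => // f _.
have [s sB ->] := steinberg_lcomb f calB_basis.
exists [seq (p.1, indic p.2) | p <- s]; last by rewrite big_map.
by move=> _ /mapP[p /sB pB ->]; exists p.2.
Qed.

Variables (Q : nonUnitalAlgType R) (t : set G -> Q).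
Hypothesis t_rep : bisection_representation calB t.

(** The list [s] followed by the negated [s'] represents the zero function, hence [t] sends it to
    zero. *)
Lemma lcomb_representation_eq (s s' : seq (R * set G)) :
  in_terms s -> in_terms s' ->
  lcomb indic s = lcomb indic s' -> lcomb t s = lcomb t s'.
Proof.
move=> sB s'B ss'; have [t0 _ tU] := t_rep.
have rB : in_terms (s ++ scale_terms (-1) s').
  by move=> p; rewrite mem_cat => /orP[/sB//|/mapP[q /s'B + ->]].
apply/eqP; rewrite -subr_eq0 -scaleN1r -lcomb_scale -lcomb_cat; apply/eqP.
apply: (additive_sum_eq0 calB_setD) => // [|x]; first exact: t0.
rewrite -lcomb_indicE => [|p /rB/calB_cob//].
by rewrite lcomb_cat lcomb_scale ss' scaleN1r subrr.
Qed.

Lemma steinberg_universal : basis calB -> exists! pi : steinberg R G -> Q,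
  algebra_hom pi /\ forall B, calB B -> pi (indic B) = t B.
Proof.
move=> calB_basis.
have /choice[c cP] : forall f, exists s, in_terms s /\ f = lcomb indic s.
  by move=> f; have [s] := steinberg_lcomb f calB_basis; exists s.
have cB f : in_terms (c f) by case: (cP f).
have cE f : lcomb indic (c f) = f by case: (cP f).
(* The chosen list [c f] is arbitrary: by [piE], any list in [calB] representing [f] gives the same
   value. *)
pose pi f := lcomb t (c f).
have piE s : in_terms s -> pi (lcomb indic s) = lcomb t s.
  by move=> sB; apply: lcomb_representation_eq.
have [_ tM _] := t_rep; have [_ iM _] := steinberg_indic_representation.
exists pi; split=> [|pi' [[lin' _] pi'E]].
  split; last first.
    move=> B cB'; have := piE [:: (1, B)].
    rewrite /lcomb !big_seq1 !scale1r; apply => p.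
    by rewrite inE => /eqP ->.
  (* The lists built from [c f] and [c g] represent the combination and the product without being
     the chosen ones; [piE] bridges the gap. *)
  split=> [a f g|f g].
    rewrite -[f in LHS]cE -[g in LHS]cE -lcomb_scale -lcomb_cat piE.
      by rewrite lcomb_cat lcomb_scale.
    by move=> p; rewrite mem_cat => /orP[/mapP[q /cB + ->]|/cB].
  rewrite -[f in LHS]cE -[g in LHS]cE -(lcomb_mul iM (cB f) (cB g)).
  rewrite [LHS]piE; first exact: (lcomb_mul tM (cB f) (cB g)).
  move=> _ /allpairsP[[p q] /= [/cB pB /cB qB ->]] /=.
  by case: calB_semigroup => _; exact.
(* Uniqueness: linearity and the values on [calB] determine [pi'] on the list [c f], term by
   term. *)
apply/funext => f; rewrite /pi -[f in RHS]cE.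
elim: (c f) (cB f) => [|[a B] s IH] sB.
  (* Linearity with scalar [-1] at two zero vectors yields [pi' 0 = 0]. *)
  rewrite /lcomb !big_nil; have := lin' (-1) 0 0.
  by rewrite scaler0 addr0 scaleN1r addNr.
rewrite /lcomb !big_cons lin' pi'E; last by apply: (sB (a, B)); rewrite mem_head.
by congr (_ + _); apply: IH => p ps; apply: sB; rewrite inE ps orbT.
Qed.

End SteinbergUniversal.

Theorem theorem3p3 (R : comPzRingType) (G : ampleGroupoidType)
    (G_hausdorff : hausdorff_space G) (calB : set (set G))
    (calB_semigroup : bisection_subsemigroup calB)
    (calB_basis : basis calB)
    (calB_set0 : calB set0) (calB_setI : setI_closed calB)
    (calB_setD : semi_setD_closed calB) :
  [/\ bisection_representation calB (@steinberg_indic R G),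
      lspan [set steinberg_indic R B | B in calB] = [set: steinberg R G] &
      forall (Q : nonUnitalAlgType R) (t : set G -> Q),
        bisection_representation calB t ->
        exists! pi : steinberg R G -> Q,
          algebra_hom pi /\
          forall B, calB B -> pi (steinberg_indic R B) = t B].
Proof.
split.
- exact: steinberg_indic_representation.
- exact: lspan_steinberg_indic.
- by move=> Q t t_rep; exact: steinberg_universal.
Qed.
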